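(* Let $k \geq 10^3$ be an integer and let $\eta = 0.999$. Consider the discrete version of the k-means problem with $k$ centers. There exists a finite dataset $X \subset \mathbb{R}^2$ (a multiset of points in the plane) such that the probability that the k-means++ seeding algorithm, run on $X$ with $k$ centers, outputs a set of centers $C$ with $\frac{\phi_C(X)}{\phi_{OPT}(X)} < \frac{9-\eta}{8}$ is at most $(2\sqrt{k}) \cdot 2^{-k/300}$.
   Context: Discrete k-means problem: given a finite multiset $X$ of points in $\mathbb{R}^d$ and an integer $k$, find a set $C \subseteq X$ of $k$ centers minimizing $\phi_C(X) = \sum_{x \in X} \min_{c \in C} D(x,c)$, where $D(x,c)$ is the squared Euclidean distance (points of a multiset are counted with multiplicity). $\phi_{OPT}(X)$ denotes the minimum of $\phi_C(X)$ over all $k$-element sets of centers $C \subseteq X$, and $\phi_C(X)/\phi_{OPT}(X)$ is the approximation factor of $C$. The k-means++ seeding algorithm chooses $k$ centers $c_1,\dots,c_k$ from $X$ as follows: $c_1$ is a uniformly random point of $X$; for $i>1$, given $C_{i-1}=\{c_1,\dots,c_{i-1}\}$, each point $x \in X$ (each copy counted separately) is chosen as $c_i$ with probability $\min_{c \in C_{i-1}} D(x,c) / \phi_{C_{i-1}}(X)$. *)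

(* Defs.v *)
From mathcomp Require Import all_boot all_order all_algebra.
From mathcomp Require Import all_classical all_reals all_analysis.
Set Implicit Arguments.
Unset Strict Implicit.
Unset Printing Implicit Defensive.
Import Order.TTheory GRing.Theory Num.Theory.
Local Open Scope ring_scope.

(* A dataset (finite multiset of points of R^d) is a [seq 'rV[R]_d]; the copies
   of a point are distinguished by their position in the sequence. *)

Definition sqdist (R : realType) (d : nat) (x c : 'rV[R]_d) : R :=
  \sum_(j < d) (x 0 j - c 0 j) ^+ 2.

(* The minimum of [sqdist x c] over c in C; the value 0 for empty C is junk. *)
Definition min_sqdist (R : realType) (d : nat) (C : seq 'rV[R]_d)
    (x : 'rV[R]_d) : R :=
  if C is c0 :: C' then \big[Num.min/sqdist x c0]_(c <- C') sqdist x c else 0.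

Definition phi (R : realType) (d : nat) (X C : seq 'rV[R]_d) : R :=
  \sum_(x <- X) min_sqdist C x.

(* k-element sets of centers C included in X, as duplicate-free sequences. *)
Definition center_set (R : realType) (d : nat) (X : seq 'rV[R]_d) (k : nat)
    (C : seq 'rV[R]_d) : Prop :=
  [/\ uniq C, size C = k & {subset C <= X}].

(* The minimum is attained, so X has at least k distinct points. Therefore
   phi X C > 0 whenever C consists of fewer than k points of X, and no division
   by 0 occurs in the seeding below. *)
Definition is_phi_opt (R : realType) (d : nat) (X : seq 'rV[R]_d) (k : nat)
    (opt : R) : Prop :=
  (exists2 C, center_set X k C & phi X C = opt) /\
  (forall C, center_set X k C -> opt <= phi X C).

(* Probability that copy number i is drawn next, given the list C of the
   centers drawn so far. *)
Definition draw_prob (R : realType) (d : nat) (X C : seq 'rV[R]_d)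
    (i : 'I_(size X)) : R :=
  if C is [::] then (size X)%:R^-1 else min_sqdist C X`_i / phi X C.

Definition drawn_points (R : realType) (d : nat) (X : seq 'rV[R]_d)
    (s : seq 'I_(size X)) : seq 'rV[R]_d :=
  [seq X`_i | i : 'I_(size X) <- s].

(* Probability that the successive draws of the seeding are exactly the copies
   listed in s (chain rule). *)
Definition seeding_prob (R : realType) (d k : nat) (X : seq 'rV[R]_d)
    (s : k.-tuple 'I_(size X)) : R :=
  \prod_(j < k) draw_prob (drawn_points (take j s)) (tnth s j).

Definition kmeanspp_Pr (R : realType) (d : nat) (X : seq 'rV[R]_d) (k : nat)
    (E : pred (seq 'rV[R]_d)) : R :=
  \sum_(s : k.-tuple 'I_(size X) | E (drawn_points s)) seeding_prob s.

(* Main.v *)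
(** The instance consists of the [k] points [(0, L j)], [j < k], together with
    [n] copies of each of [(1, 0)] and [(-1, 0)], where [L] is large compared to
    [n] and [n] is exponentially large.  The [k] axis points form the optimal
    set of centers, of cost [2 n]: missing a far axis point costs [L ^ 2], and
    replacing the origin by a side point costs [4 n].  Hence a good run draws
    exactly the axis points, which leaves at most [k ^ k] outcomes; each of them
    draws the origin while all earlier centers are on the axis, and such a draw
    has probability at most [1 / (2 n)] because every side point is then at
    least as far from the centers as the origin. *)

Require Import Defs.
From mathcomp Require Import all_boot all_order all_algebra.
From mathcomp Require Import all_classical all_reals all_analysis.
From mathcomp Require Import ring lra.
Set Implicit Arguments.
Unset Strict Implicit.
Unset Printing Implicit Defensive.
Import Order.TTheory GRing.Theory Num.Theory.
Local Open Scope ring_scope.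

(** * General bounds on costs and draw probabilities *)

Section Costs.
Context {R : realType} {d : nat}.
Implicit Types (x c : 'rV[R]_d) (X C : seq 'rV[R]_d).

Lemma sqdist_ge0 x c : 0 <= sqdist x c.
Proof. by apply: sumr_ge0 => j _; exact: sqr_ge0. Qed.

Lemma min_sqdist_le C x c : c \in C -> min_sqdist C x <= sqdist x c.
Proof.
case: C => [//|c0 C] /=; rewrite inE.
elim: C => [|c1 C IH]; first by rewrite orbF big_nil => /eqP ->.
rewrite big_cons inE orbCA ge_min => /orP[/eqP ->|/IH ->].
  by rewrite lexx.
by rewrite orbT.
Qed.

(** Nonemptiness of [C] excludes the default value 0. *)
Lemma le_min_sqdist C x (r : R) : C != [::] ->
  {in C, forall c, r <= sqdist x c} -> r <= min_sqdist C x.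
Proof.
case: C => [//|c0 C] _ /= hr.
rewrite big_seq; apply: (big_ind (fun y => r <= y)).
- by apply: hr; rewrite mem_head.
- by move=> y z ry rz; rewrite le_min ry.
- by move=> c cC; apply: hr; rewrite inE cC orbT.
Qed.

Lemma min_sqdist_ge0 C x : 0 <= min_sqdist C x.
Proof.
by case: C => [//|c0 C]; apply: le_min_sqdist => // c _; exact: sqdist_ge0.
Qed.

Lemma phi_ge0 X C : 0 <= phi X C.
Proof. by apply: sumr_ge0 => x _; exact: min_sqdist_ge0. Qed.

Lemma min_sqdist_le_phi X C x : x \in X -> min_sqdist C x <= phi X C.
Proof.
move=> xX; rewrite /phi (big_rem x) //= lerDl.
by apply: sumr_ge0 => y _; exact: min_sqdist_ge0.
Qed.

Lemma phi_anti X C C' : C != [::] -> {subset C <= C'} -> phi X C' <= phi X C.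
Proof.
move=> C0 sCC'; apply: ler_sum => x _; apply: le_min_sqdist => // c cC.
by apply: min_sqdist_le; exact: sCC'.
Qed.

Lemma draw_prob_ge0 X C (i : 'I_(size X)) : 0 <= draw_prob C i.
Proof.
case: C => [|c C]; first by rewrite invr_ge0.
by rewrite divr_ge0 ?min_sqdist_ge0 ?phi_ge0.
Qed.

(** The bound [r <= (size X)%:R] serves the uniform first draw, the last hypothesis all later
    draws. *)
Lemma draw_prob_le_inv X C (i : 'I_(size X)) (r : R) :
  0 < r -> r <= (size X)%:R ->
  (C != [::] -> r * min_sqdist C X`_i <= phi X C) ->
  draw_prob C i <= r^-1.
Proof.
move=> r0 rX; case: C => [_|c C /(_ isT) rC] /=.
  by rewrite lef_pV2 // posrE (lt_le_trans r0).
(* If the cost vanishes, the quotient is 0 by the convention on the inverse of 0. *)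
have := phi_ge0 X (c :: C); rewrite le_eqVlt => /predU1P[<-|phi0].
  by rewrite invr0 mulr0 invr_ge0 ltW.
by rewrite ler_pdivrMr // mulrC ler_pdivlMr // mulrC.
Qed.

Lemma draw_prob_le1 X C (i : 'I_(size X)) : draw_prob C i <= 1.
Proof.
rewrite -[leRHS]invr1; apply: draw_prob_le_inv => [//||_].
  by rewrite ler1n (leq_ltn_trans _ (ltn_ord i)).
by rewrite mul1r min_sqdist_le_phi // mem_nth.
Qed.

(** All factors lie in [0, 1], so any single one bounds the product. *)
Lemma seeding_prob_le k X (s : k.-tuple 'I_(size X)) (j : 'I_k) (r : R) :
  draw_prob (drawn_points (take j s)) (tnth s j) <= r -> seeding_prob s <= r.
Proof.
move=> hr; rewrite /seeding_prob (bigD1 j) //= -[leRHS]mulr1.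
apply: ler_pM => //; first exact: draw_prob_ge0.
  by apply: prodr_ge0 => i _; exact: draw_prob_ge0.
by apply: prodr_ile1 => i _; rewrite draw_prob_ge0 draw_prob_le1.
Qed.

End Costs.

(** Used with [m = k] to count the runs that draw only axis points, which occupy the first [k]
    positions of the dataset. *)
Lemma card_tuple_lt_ord (N m k : nat) :
  (#|[set s : k.-tuple 'I_N | all (fun i : 'I_N => (i < m)%N) s]| <= m ^ k)%N.
Proof.
case: N => [|N].
  case: k => [|k]; last first.
    by rewrite (leq_trans (max_card _)) // card_tuple card_ord exp0n //.
  by rewrite (leq_trans (max_card _)) // card_tuple.
rewrite -[X in (X ^ k)%N]card_ord -card_tuple.
(* The image of [f] covers the set; out-of-range values of [inord] are harmless, since only covering
   is needed. *)
pose f (t : k.-tuple 'I_m) :=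
  [tuple of map (fun i : 'I_m => inord i : 'I_N.+1) t].
rewrite -cardsT (leq_trans _ (leq_imset_card f _)) // subset_leq_card //.
apply/fintype.subsetP => s; rewrite inE => /allP hs.
have lt_s j : (tnth s j < m)%N by apply: hs; exact: mem_tnth.
apply/imsetP; exists [tuple Ordinal (lt_s j) | j < k]; first by rewrite inE.
by apply: eq_from_tnth => j; rewrite tnth_map tnth_mktuple /= inord_val.
Qed.

(** * The instance *)

Section Instance.
Context {R : realType} (k n : nat).
Implicit Types (x : 'rV[R]_2) (C : seq 'rV[R]_2).
Hypotheses (k_gt0 : (0 < k)%N) (n_gt0 : (0 < n)%N).

Definition point (a b : R) : 'rV[R]_2 := \row_j (if j == 0 then a else b).

Lemma sqdist_point (a b a' b' : R) :
  sqdist (point a b) (point a' b') = (a - a') ^+ 2 + (b - b') ^+ 2.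
Proof. by rewrite /sqdist !big_ord_recl big_ord0 !mxE /= addr0. Qed.

Lemma point_inj (a b a' b' : R) : point a b = point a' b' -> a = a' /\ b = b'.
Proof. by move=> /rowP e; have := e 0; have := e 1; rewrite !mxE /=. Qed.

(** The spacing [2 * n] makes squared distances at least [4 * n ^ 2 >= 4 * n], twice the optimal
    cost. *)
Definition axis_point (j : nat) : 'rV[R]_2 := point 0 ((2 * n * j)%:R).
Definition axis : seq 'rV[R]_2 := [seq axis_point j | j <- iota 0 k].
Definition right_point : 'rV[R]_2 := point 1 0.
Definition left_point : 'rV[R]_2 := point (-1) 0.
Definition dataset : seq 'rV[R]_2 :=
  axis ++ nseq n right_point ++ nseq n left_point.

Lemma axis_point_inj : injective axis_point.
Proof.
move=> i j /point_inj[_ /eqP]; rewrite eqr_nat !eqn_pmul2l //.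
  by move/eqP.
by rewrite muln_gt0.
Qed.

Lemma axis_uniq : uniq axis.
Proof. by rewrite map_inj_uniq ?iota_uniq //; exact: axis_point_inj. Qed.

Lemma size_axis : size axis = k.
Proof. by rewrite size_map size_iota. Qed.

Lemma axis_neq0 : axis != [::].
Proof. by rewrite -size_eq0 size_axis -lt0n. Qed.

Lemma origin_axis : axis_point 0 \in axis.
Proof. by apply: map_f; rewrite mem_iota. Qed.

Lemma axisP x : reflect (exists2 j, (j < k)%N & x = axis_point j) (x \in axis).
Proof.
apply: (iffP mapP) => -[j]; first by rewrite mem_iota => hj ->; exists j.
by move=> hj ->; exists j => //; rewrite mem_iota.
Qed.

Lemma mem_dataset x :
  (x \in dataset) = [|| x \in axis, x == right_point | x == left_point].
Proof. by rewrite !mem_cat !mem_nseq n_gt0. Qed.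

Lemma axis_sub_dataset : {subset axis <= dataset}.
Proof. by move=> x xA; rewrite mem_dataset xA. Qed.

Lemma right_notin_axis : right_point \notin axis.
Proof.
by apply/axisP => -[j _ /point_inj[/eqP]]; rewrite oner_eq0.
Qed.

Lemma left_notin_axis : left_point \notin axis.
Proof.
by apply/axisP => -[j _ /point_inj[/eqP]]; rewrite oppr_eq0 oner_eq0.
Qed.

Lemma right_neq_left : right_point != left_point.
Proof. by apply/eqP => /point_inj[? _]; lra. Qed.

(** * Costs of center sets on the instance *)

Lemma phi_dataset C :
  phi dataset C = phi axis C
    + (n%:R * min_sqdist C right_point + n%:R * min_sqdist C left_point).
Proof.
have nseqE x : \sum_(y <- nseq n x) min_sqdist C y = n%:R * min_sqdist C x.
  by rewrite big_nseq iter_addr_0 mulr_natl.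
by rewrite /phi !big_cat /= !nseqE.
Qed.

Lemma sqdist_right_axis j :
  sqdist right_point (axis_point j) = 1 + sqdist (axis_point 0) (axis_point j).
Proof. by rewrite !sqdist_point muln0; ring. Qed.

Lemma sqdist_left_axis j :
  sqdist left_point (axis_point j) = 1 + sqdist (axis_point 0) (axis_point j).
Proof. by rewrite !sqdist_point muln0; ring. Qed.

Lemma sqdist_axis_ge i j : i != j ->
  4 * n%:R <= sqdist (axis_point i) (axis_point j).
Proof.
move=> ij; rewrite sqdist_point subrr expr0n add0r !natrM -mulrBr exprMn.
have h : 1 <= (i%:R - j%:R) ^+ 2 :> R.
  case: (ltngtP i j) ij => // [lt_ij|lt_ji] _.
  - have : i%:R + 1 <= j%:R :> R by rewrite natr1 ler_nat.
    by nra.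
  - have : j%:R + 1 <= i%:R :> R by rewrite natr1 ler_nat.
    by nra.
have n1 : 1 <= n%:R :> R by rewrite ler1n.
by nra.
Qed.

(** Axis points cost 0, and each of the [2 * n] side copies costs 1, attained at the origin. *)
Lemma phi_axis : phi dataset axis = (2 * n)%:R.
Proof.
have min1 x : (forall j, sqdist x (axis_point j)
    = 1 + sqdist (axis_point 0) (axis_point j)) -> min_sqdist axis x = 1.
  move=> hx; apply/le_anti/andP; split.
    rewrite (le_trans (min_sqdist_le _ origin_axis)) // hx sqdist_point.
    by rewrite !subrr expr0n /= !addr0.
  apply: le_min_sqdist axis_neq0 _ => c /axisP[j _ ->].
  by rewrite hx lerDl sqdist_ge0.
rewrite phi_dataset (min1 _ sqdist_right_axis) (min1 _ sqdist_left_axis).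
suff -> : phi axis axis = 0 by rewrite natrM; ring.
rewrite /phi big1_seq // => x /andP[_ xA]; apply/le_anti.
rewrite min_sqdist_ge0 andbT (le_trans (min_sqdist_le _ xA)) //.
by rewrite /sqdist big1 // => j _; rewrite subrr expr0n.
Qed.

(** The missed point alone pays this much: other axis points are far by the spacing, and side points
    are farther from it than the origin. *)
Lemma phi_miss_far C j : {subset C <= dataset} -> C != [::] -> (0 < j < k)%N ->
  axis_point j \notin C -> (4 * n)%:R <= phi dataset C.
Proof.
move=> sC C0 /andP[j0 jk] jC.
have jX : axis_point j \in dataset.
  by apply: axis_sub_dataset; apply/axisP; exists j.
apply: le_trans (min_sqdist_le_phi C jX).
apply: le_min_sqdist => // c cC; rewrite natrM.
have h0 : 4 * n%:R <= sqdist (axis_point j) (axis_point 0).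
  by apply: sqdist_axis_ge; rewrite -lt0n.
have := sC _ cC; rewrite mem_dataset => /or3P[/axisP[i _ ci]|/eqP->|/eqP->].
- by rewrite ci sqdist_axis_ge //; apply: contraNneq jC => ->; rewrite -ci.
- by move: h0; rewrite !sqdist_point muln0; lra.
- by move: h0; rewrite !sqdist_point muln0; lra.
Qed.

(** Each of the [n] copies of an unchosen side point pays at least 4, whether its nearest center is
    the opposite side point or a far axis point. *)
Lemma phi_miss_origin C : {subset C <= dataset} -> C != [::] ->
  axis_point 0 \notin C -> right_point \notin C \/ left_point \notin C ->
  (4 * n)%:R <= phi dataset C.
Proof.
move=> sC C0 oC sides.
have n1 : 1 <= n%:R :> R by rewrite ler1n.
have far i : axis_point i \in C ->
    4 <= sqdist (axis_point 0) (axis_point i).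
  move=> iC; apply: le_trans (sqdist_axis_ge _); first lra.
  by apply: contraNneq oC => i0; rewrite [X in axis_point X]i0.
have pA := phi_ge0 axis C.
have pr := min_sqdist_ge0 C right_point.
have pl := min_sqdist_ge0 C left_point.
rewrite phi_dataset natrM; case: sides => sideC.
- suff : 4 <= min_sqdist C right_point by nra.
  apply: le_min_sqdist => // c cC.
  have := sC _ cC; rewrite mem_dataset => /or3P[/axisP[i _ ci]|/eqP ce|/eqP->].
  + by move: cC; rewrite ci sqdist_right_axis => /far; lra.
  + by move: sideC; rewrite -ce cC.
  + by rewrite sqdist_point; lra.
- suff : 4 <= min_sqdist C left_point by nra.
  apply: le_min_sqdist => // c cC.
  have := sC _ cC; rewrite mem_dataset => /or3P[/axisP[i _ ci]|/eqP->|/eqP ce].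
  + by move: cC; rewrite ci sqdist_left_axis => /far; lra.
  + by rewrite sqdist_point; lra.
  + by move: sideC; rewrite -ce cC.
Qed.

Lemma axis_sub_or_phi_ge C : size C = k -> {subset C <= dataset} ->
  {subset axis <= C} \/ (4 * n)%:R <= phi dataset C.
Proof.
move=> szC sC; have C0 : C != [::] by rewrite -size_eq0 szC -lt0n.
have [/allP|/allPn[_ /axisP[j jk ->] jC]] := boolP (all (mem C) axis).
  by left.
right; case: (posnP j) => [j0|j0]; last first.
  by apply: phi_miss_far jC => //; rewrite j0.
have [/allP far|/allPn[i]] :=
    boolP (all (fun i => axis_point i \in C) (iota 1 k.-1)); last first.
  rewrite mem_iota add1n prednK // => hi iC; exact: phi_miss_far iC.
rewrite j0 in jC; apply: phi_miss_origin => //.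
have [rC|] := boolP (right_point \in C); last by left.
right; apply/negP => lC.
(* Otherwise the [k - 1] far axis points and both side points would be [k + 1] distinct members of
   [C]. *)
have : (k.+1 <= k)%N; last by rewrite ltnn.
pose B := [seq axis_point i | i <- iota 1 k.-1].
have sBA : {subset B <= axis}.
  move=> x /mapP[i]; rewrite mem_iota add1n prednK // => /andP[_ ik] ->.
  by apply/axisP; exists i.
have <- : size [:: right_point, left_point & B] = k.+1.
  by rewrite /= size_map size_iota prednK.
rewrite -[leqRHS]szC; apply: uniq_leq_size => /=.
  rewrite inE negb_or right_neq_left (contraNN (sBA _) right_notin_axis).
  rewrite (contraNN (sBA _) left_notin_axis) map_inj_uniq ?iota_uniq //.
  exact: axis_point_inj.
move=> x; rewrite !inE => /or3P[/eqP->//|/eqP->//|/mapP[i /far]].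
by move=> ? ->.
Qed.

(** The [k] distinct axis points already fill the [k] entries of [C]. *)
Lemma sub_axis C : size C = k -> {subset axis <= C} -> {subset C <= axis}.
Proof.
move=> szC sAC x xC.
by rewrite (uniq_min_size axis_uniq sAC) // szC size_axis.
Qed.

Lemma is_phi_opt_dataset : is_phi_opt dataset k (2 * n)%:R.
Proof.
split.
  exists axis; last exact: phi_axis.
  split; [exact: axis_uniq|exact: size_axis|exact: axis_sub_dataset].
move=> C [_ szC sC].
case: (axis_sub_or_phi_ge szC sC) => [/(sub_axis szC) sCA|].
  by rewrite -phi_axis phi_anti // -size_eq0 szC -lt0n.
by apply: le_trans; rewrite ler_nat leq_pmul2r.
Qed.

(** * Probability of a good run *)

Lemma draw_prob_origin C (i : 'I_(size dataset)) :
  {subset C <= axis} -> dataset`_i = axis_point 0 ->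
  draw_prob C i <= ((2 * n)%:R)^-1.
Proof.
move=> sC iE; apply: draw_prob_le_inv.
- by rewrite ltr0n muln_gt0.
- by rewrite ler_nat !size_cat !size_nseq mul2n -addnn leq_addl.
move=> C0; rewrite iE phi_dataset natrM.
have side x : (forall j, sqdist x (axis_point j)
    = 1 + sqdist (axis_point 0) (axis_point j)) ->
    min_sqdist C (axis_point 0) <= min_sqdist C x.
  move=> hx; apply: le_min_sqdist => // c cC.
  apply: le_trans (min_sqdist_le _ cC) _.
  by have /axisP[j _ ->] := sC _ cC; rewrite hx lerDr.
have := side _ sqdist_right_axis; have := side _ sqdist_left_axis.
have := phi_ge0 axis C.
have n1 : 1 <= n%:R :> R by rewrite ler1n.
by nra.
Qed.

Lemma kmeanspp_Pr_dataset (E : pred (seq 'rV[R]_2)) :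
  (forall C, E C -> phi dataset C < (4 * n)%:R) ->
  kmeanspp_Pr dataset k E <= (k ^ k)%:R / (2 * n)%:R.
Proof.
move=> hE; pose good := [set s : k.-tuple 'I_(size dataset) |
  all (fun i : 'I_(size dataset) => (i < k)%N) s].
have axisE (s : k.-tuple 'I_(size dataset)) : E (drawn_points s) ->
    {subset axis <= drawn_points s} /\ {subset drawn_points s <= axis}.
  move=> /hE lt_phi.
  have sz : size (drawn_points s) = k by rewrite size_map size_tuple.
  have sX : {subset drawn_points s <= dataset}.
    by move=> x /mapP[i _ ->]; rewrite mem_nth.
  case: (axis_sub_or_phi_ge sz sX) => [sA|]; last by rewrite leNgt lt_phi.
  by split => //; exact: sub_axis.
rewrite /kmeanspp_Pr.
apply: (@le_trans _ _ (\sum_(s in good) ((2 * n)%:R)^-1)); last first.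
  rewrite sumr_const -[leLHS]mulr_natl ler_wpM2r ?invr_ge0 // ler_nat.
  exact: card_tuple_lt_ord.
have sEgood (s : k.-tuple 'I_(size dataset)) :
    E (drawn_points s) -> s \in good.
  move=> /axisE[_ sA]; rewrite inE; apply/allP => i si.
  have : dataset`_i \in axis by apply: sA; apply: map_f.
  (* Positions from [k] on hold side points, which are off the axis. *)
  rewrite ltnNge; apply: contraTN => ki.
  have : dataset`_i \in nseq n right_point ++ nseq n left_point.
    rewrite /dataset nth_cat size_axis ltnNge ki /= mem_nth //.
    by rewrite ltn_subLR // -[X in (X + _)%N]size_axis -size_cat.
  rewrite mem_cat !mem_nseq => /orP[] /andP[_ /eqP->].
    exact: right_notin_axis.
  exact: left_notin_axis.
(* The constant sum over [good] is split along [E], and the nonnegative part outside [E] is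
   dropped. *)
rewrite [leRHS](bigID (fun s : k.-tuple _ => E (drawn_points s))) /=.
rewrite -[leLHS]addr0; apply: lerD; last by apply: sumr_ge0 => s _.
rewrite [leRHS](eq_bigl (fun s : k.-tuple _ => E (drawn_points s))); last first.
  by move=> s /=; apply: andb_idl; exact: sEgood.
apply: ler_sum => s /axisE[sA1 sA2].
(* The run is bounded by its factor at a step [j] that draws the origin. *)
have /mapP[i si iE] := sA1 _ origin_axis.
have /tnthP[j ij] := si; apply: (@seeding_prob_le _ _ _ _ _ j).
apply: draw_prob_origin; last by rewrite -ij.
move=> x /mapP[i' /mem_take hi' ->]; apply: sA2; exact: map_f.
Qed.

End Instance.

(** * Choice of the multiplicity and conclusion *)

Theorem theorem1 (R : realType) (k : nat) (hk : (10 ^ 3 <= k)%N) (eta : R)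
    (heta : eta = 999 / 1000) :
  exists (X : seq 'rV[R]_2) (opt : R),
    [/\ is_phi_opt X k opt, 0 < opt &
      kmeanspp_Pr X k (fun C => phi X C / opt < (9 - eta) / 8)
        <= (2 * Num.sqrt k%:R) * 2 `^ (- (k%:R / 300))].
Proof.
have k0 : (0 < k)%N by apply: leq_trans hk.
(* The factor [k ^ k] cancels the number of outcomes; [2 ^ k] supplies the exponential decay. *)
pose n := (k ^ k * 2 ^ k)%N.
have n0 : (0 < n)%N by rewrite muln_gt0 !expn_gt0 k0.
have opt0 : 0 < (2 * n)%:R :> R by rewrite ltr0n muln_gt0.
exists (dataset k n), (2 * n)%:R; split => //; first exact: is_phi_opt_dataset.
apply: le_trans (kmeanspp_Pr_dataset k0 n0 _) _.
  (* The threshold [(9 - eta) / 8] is below 2, so such a [C] costs less than twice the optimum, that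
     is [4 * n]. *)
  move=> C; rewrite ltr_pdivrMr // heta => h; apply: lt_le_trans h _.
  by move: opt0; rewrite !natrM; lra.
have sqrt1 : 1 <= Num.sqrt k%:R :> R.
  by rewrite -[leLHS]sqrtr1 ler_wsqrtr // ler1n.
have pow : (2 ^+ k)^-1 <= 2 `^ (- (k%:R / 300)) :> R.
  rewrite -powR_mulrn // -powRN ler_powR ?ler1n // lerN2.
  by rewrite ler_pdivrMr // ler_peMr // ler1n.
have kk0 : (k ^ k)%:R != 0 :> R by rewrite pnatr_eq0 -lt0n expn_gt0 k0.
have -> : (k ^ k)%:R / (2 * n)%:R = (2 ^+ k)^-1 / 2 :> R.
  rewrite /n !natrM (natrX _ 2 k) !invfM [X in _ * X]mulrC !mulrA divff //.
  by rewrite mul1r.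
have : 0 < (2 ^+ k)^-1 :> R by rewrite invr_gt0 exprn_gt0.
by nra.
Qed.
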